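(* For $n\ge3$, each of the statistics $\operatorname{inv}$, $\operatorname{inv}_B$, and $\operatorname{des}_B$ on $B_n$ has degree $2$; that is, each lies in the real span of the indicator functions of partial colored permutations of size at most $2$, but not in the real span of the indicator functions of partial colored permutations of size at most $1$.
   Context: $B_n$ is the group of permutations $\omega$ of $\{\pm1,\dots,\pm n\}$ with $\omega(-i)=-\omega(i)$. $\operatorname{inv}(\omega)=|\{(i,j)\in[n]^2:i<j,\ \omega(i)>\omega(j)\}|$, $\operatorname{neg}(\omega)=\sum_{i\in[n],\,\omega(i)<0}\omega(i)$, $\operatorname{inv}_B=\operatorname{inv}-\operatorname{neg}$, and $\operatorname{des}_B(\omega)=|\{i\in\{0,\dots,n-1\}:\omega(i)>\omega(i+1)\}|$ with $\omega(0)=0$. A partial colored permutation of size $m$ on $B_n$ is a set $\{(i_h,k_h)\}_{h=1}^m$ with $i_h\in[n]$ distinct, $k_h\in\{\pm1,\dots,\pm n\}$ and $|k_h|$ distinct; its indicator function takes value $1$ on $\omega$ if $\omega(i_h)=k_h$ for all $h$ and $0$ otherwise. (The size-$0$ partial colored permutation has the constant function $1$ as indicator.) *)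

(* Defs.v *)
From HB Require Import structures.
From mathcomp Require Import all_boot all_order all_algebra all_fingroup.
From mathcomp Require Import reals.

Set Implicit Arguments.
Unset Strict Implicit.
Unset Printing Implicit Defensive.

Import Order.TTheory GRing.Theory Num.Theory.
Local Open Scope ring_scope.

(* The index set [n] = {1, ..., n} is represented by 'I_n, the ordinal i
   standing for i + 1.  The set {+-1, ..., +-n} is represented by pairs of a
   sign and an absolute value, with [true] for a negative sign. *)
Notation pm n := (bool * 'I_n)%type.

Definition pm_int n (x : pm n) : int := (-1) ^+ x.1 * (x.2.+1)%:Z.

Definition pm_pos n (i : 'I_n) : pm n := (false, i).

Definition pm_opp n (x : pm n) : pm n := (~~ x.1, x.2).

Definition pm_abs n (x : pm n) : 'I_n := x.2.

Definition hyperoctahedral n : {set {perm pm n}} :=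
  [set w : {perm pm n} | [forall x, w (pm_opp x) == pm_opp (w x)]].

Lemma hyperoctahedral_group_set n : group_set (hyperoctahedral n).
Proof.
apply/group_setP; split=> [|u v].
  by rewrite inE; apply/forallP=> x; rewrite !perm1.
rewrite !inE => /forallP hu /forallP hv; apply/forallP=> x.
by rewrite !permM (eqP (hu x)) (eqP (hv _)).
Qed.

Canonical hyperoctahedral_group n := Group (hyperoctahedral_group_set n).

(* The elements of the group B_n. *)
Notation signed_perm n := (subg_of (hyperoctahedral_group n)).

Definition sp_fun n (w : signed_perm n) : pm n -> pm n :=
  (sgval w : {perm pm n}).

Definition entry n (w : signed_perm n) (i : 'I_n) : int :=
  pm_int (sp_fun w (pm_pos i)).

(* [entry0 w i] is w(i) for i in {0, ..., n}, with the convention w(0) = 0;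
   the value 0 for i > n is never used. *)
Definition entry0 n (w : signed_perm n) (i : nat) : int :=
  if i is j.+1 then oapp (entry w) 0 (insub j) else 0.

Definition sp_inv n (w : signed_perm n) : nat :=
  #|[set ij : 'I_n * 'I_n | (ij.1 < ij.2)%N & entry w ij.1 > entry w ij.2]|.

Definition sp_neg n (w : signed_perm n) : int :=
  \sum_(i < n | entry w i < 0) entry w i.

Definition sp_invB n (w : signed_perm n) : int := (sp_inv w)%:Z - sp_neg w.

Definition sp_desB n (w : signed_perm n) : nat :=
  #|[set i : 'I_n | entry0 w i > entry0 w i.+1]|.

(* A partial colored permutation {(i_h, k_h)} is a set of pairs on which both
   (i, k) |-> i and (i, k) |-> |k| are injective; its size is its cardinal. *)
Definition partial_colored_perm n (K : {set 'I_n * pm n}) : bool :=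
  dinjectiveb (fun p => p.1) K && dinjectiveb (fun p => pm_abs p.2) K.

Section Span.
Variables (R : realType) (n : nat).

(* R^o, i.e. R as a module over itself, gives the functions B_n -> R their
   R-vector space structure. *)
Definition indicator (K : {set 'I_n * pm n}) : {ffun signed_perm n -> R^o} :=
  [ffun w => [forall p in K, sp_fun w (pm_pos p.1) == p.2]%:R].

Definition pcp_span (m : nat) : {vspace {ffun signed_perm n -> R^o}} :=
  <<[seq indicator K | K : {set 'I_n * pm n}
                       in [pred K | partial_colored_perm K & (#|K| <= m)%N]]>>%VS.

Definition statistic (f : signed_perm n -> int) : {ffun signed_perm n -> R^o} :=
  [ffun w => (f w)%:~R].

End Span.

(* Main.v *)
From HB Require Import structures.
Require Import Defs.
From mathcomp Require Import all_boot all_order all_algebra all_fingroup.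
From mathcomp Require Import reals.
From mathcomp Require Import ring.

Set Implicit Arguments.
Unset Strict Implicit.
Unset Printing Implicit Defensive.

Import Order.TTheory GRing.Theory Num.Theory.
Local Open Scope ring_scope.

(** Each statistic is a sum of functions of one or two values of the signed
    permutation, hence of degree at most 2.  Conversely, the alternating sum
    over the copy of S_3 permuting the first three positions kills every
    indicator of size at most 1, since fixing one value of a permutation in
    S_3 leaves one even and one odd choice; but it takes the value -1 on inv
    and inv_B, and -2 on des_B. *)

(** * Upper bound: the statistics have degree at most 2 *)

Section UpperBound.
Variables (R : realType) (n : nat).
Implicit Types (w : signed_perm n) (i j : 'I_n) (k l : pm n).

(** If the signs agree, injectivity of [w] applies. If they differ, then [w(i) = -w(j) = w(-j)],
    which would force [i = -j] for two positive arguments. *)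
Lemma sp_fun_pos_eq w i j :
  (sp_fun w (pm_pos i)).2 = (sp_fun w (pm_pos j)).2 -> i = j.
Proof.
move: (subgP w); rewrite inE => /forallP oppw.
rewrite /sp_fun => e; set u := sgval w in oppw e.
case: (eqVneq (u (pm_pos i)).1 (u (pm_pos j)).1) => e1.
  have : u (pm_pos i) = u (pm_pos j).
    by rewrite [LHS]surjective_pairing [RHS]surjective_pairing e e1.
  by move/perm_inj => [].
have : u (pm_pos i) = u (pm_opp (pm_pos j)).
  rewrite (eqP (oppw _)) [LHS]surjective_pairing e /pm_opp; congr pair.
  by move: e1; do 2!case: (_.1).
by move/perm_inj.
Qed.

Lemma indicator_in_pcp_span m (K : {set 'I_n * pm n}) :
  partial_colored_perm K -> (#|K| <= m)%N ->
  indicator R K \in pcp_span R n m.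
Proof.
move=> cK sK; apply: memv_span; apply/imageP; exists K => //.
by rewrite inE cK sK.
Qed.

(** Expand over the possible values [k] of [w] at [i]: at each [w] exactly one of the indicators of
    [(i, k)] is nonzero. *)
Lemma one_value_in_pcp_span m i (g : pm n -> R) : (0 < m)%N ->
  ([ffun w => g (sp_fun w (pm_pos i))] : {ffun signed_perm n -> R^o})
    \in pcp_span R n m.
Proof.
move=> m_gt0.
suff -> : [ffun w => g (sp_fun w (pm_pos i))] =
    \sum_k (g k : R) *: indicator R [set (i, k)].
  apply: memv_suml => k _; apply: memvZ; apply: indicator_in_pcp_span.
    by apply/andP; split; apply/dinjectiveP=> x y /set1P-> /set1P->.
  by rewrite cards1.
apply/ffunP=> w; rewrite sum_ffunE ffunE (bigD1 (sp_fun w (pm_pos i))) //=.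
rewrite big1 ?addr0 => [|k nk].
  rewrite !ffunE; case: forall_inP => [_|[x /set1P-> //]].
  by rewrite [_ *: _]mulr1.
rewrite !ffunE; case: forall_inP => [/(_ (i, k) (set11 _)) /= e|_].
  by rewrite (eqP e) eqxx in nk.
by rewrite scaler0.
Qed.

Lemma two_values_in_pcp_span i j (g : pm n -> pm n -> R) : i != j ->
  ([ffun w => g (sp_fun w (pm_pos i)) (sp_fun w (pm_pos j))]
     : {ffun signed_perm n -> R^o}) \in pcp_span R n 2.
Proof.
move=> nij.
(* Only pairs of values with distinct absolute values give a partial colored permutation; by
   [sp_fun_pos_eq] the other pairs never occur. *)
suff -> : [ffun w => g (sp_fun w (pm_pos i)) (sp_fun w (pm_pos j))] =
    \sum_(kl : pm n * pm n | kl.1.2 != kl.2.2)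
      (g kl.1 kl.2 : R) *: indicator R [set (i, kl.1); (j, kl.2)].
  apply: memv_suml => -[k l] /= nkl; apply: memvZ.
  apply: indicator_in_pcp_span; last by rewrite cards2; case: (_ != _).
  apply/andP; split; apply/dinjectiveP=> x y;
    case/set2P=> ->; case/set2P=> -> //= /eqP.
  - by rewrite (negPf nij).
  - by rewrite eq_sym (negPf nij).
  - by rewrite /pm_abs (negPf nkl).
  - by rewrite /pm_abs eq_sym (negPf nkl).
apply/ffunP=> w; rewrite sum_ffunE ffunE.
rewrite (bigD1 (sp_fun w (pm_pos i), sp_fun w (pm_pos j))) /=; last first.
  by apply: contra nij => /eqP /sp_fun_pos_eq ->.
rewrite big1 ?addr0 => [|[k l] /andP[_ nkl]].
  rewrite !ffunE; case: forall_inP => [_|[x /set2P[]-> //]].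
  by rewrite [_ *: _]mulr1.
rewrite !ffunE; case: forall_inP => [h|_]; last by rewrite scaler0.
move: nkl (h (i, k) (set21 _ _)) (h (j, l) (set22 _ _)) => /=.
by move=> /negP nkl /eqP ek /eqP el; case: nkl; rewrite ek el.
Qed.

Lemma sp_inv_in_pcp_span :
  statistic R (fun w => (sp_inv w)%:Z) \in pcp_span R n 2.
Proof.
pose g k l : R := (pm_int l < pm_int k)%R%:R.
suff -> : statistic R (fun w => (sp_inv w)%:Z) =
    \sum_(ij : 'I_n * 'I_n | (ij.1 < ij.2)%N)
      [ffun w => g (sp_fun w (pm_pos ij.1)) (sp_fun w (pm_pos ij.2))].
  apply: memv_suml => -[i j] /= lij; apply: two_values_in_pcp_span.
  by apply: contraTneq lij => ->; rewrite ltnn.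
apply/ffunP=> w; rewrite sum_ffunE ffunE /sp_inv -sum1dep_card.
rewrite big_mkcondr /= -pmulrn natr_sum.
by apply: eq_bigr => ij _; rewrite ffunE /g /entry; case: (_ < _).
Qed.

Lemma sp_invB_in_pcp_span : statistic R (@sp_invB n) \in pcp_span R n 2.
Proof.
pose g k : R := (if pm_int k < 0 then pm_int k else 0)%:~R.
suff -> : statistic R (@sp_invB n) = statistic R (fun w => (sp_inv w)%:Z) -
    \sum_(i < n) [ffun w => g (sp_fun w (pm_pos i))].
  apply: memvB sp_inv_in_pcp_span _.
  by apply: memv_suml => i _; apply: one_value_in_pcp_span.
apply/ffunP=> w; rewrite !ffunE /sp_invB rmorphB /=; congr (_ - _).
rewrite sum_ffunE /sp_neg big_mkcond /= rmorph_sum /=.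
by apply: eq_bigr => i _; rewrite ffunE.
Qed.

Lemma entry0S w i : entry0 w i.+1 = entry w i.
Proof. by rewrite /= valK. Qed.

Lemma sp_desB_in_pcp_span :
  statistic R (fun w => (sp_desB w)%:Z) \in pcp_span R n 2.
Proof.
suff -> : statistic R (fun w => (sp_desB w)%:Z) =
    \sum_(i < n) [ffun w => (entry0 w i.+1 < entry0 w i)%R%:R].
  apply: memv_suml => i _; case: i => -[|i] lti.
    pose g k : R := (pm_int k < 0)%R%:R.
    apply: etrans (@one_value_in_pcp_span 2 (Ordinal lti) g isT).
    apply: (congr1 (mem (pcp_span R n 2))); apply/ffunP=> w; rewrite !ffunE.
    by rewrite (entry0S w (Ordinal lti)).
  pose g k l : R := (pm_int l < pm_int k)%R%:R.
  have nij : Ordinal (ltnW lti) != Ordinal lti.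
    by rewrite -val_eqE /= neq_ltn leqnn.
  apply: etrans (two_values_in_pcp_span g nij).
  apply: (congr1 (mem (pcp_span R n 2))); apply/ffunP=> w.
  rewrite !ffunE (entry0S w (Ordinal lti)).
  by rewrite (entry0S w (Ordinal (ltnW lti))).
apply/ffunP=> w; rewrite sum_ffunE ffunE /sp_desB -sum1dep_card.
rewrite big_mkcond /= -pmulrn natr_sum.
by apply: eq_bigr => i _; rewrite ffunE; case: ifP.
Qed.

End UpperBound.

(** * Lower bound: the statistics on the copy of [S_3] *)

Section LowerBound.
Variables (R : realType) (m : nat).
Local Notation n := m.+3.

Lemma unsigned_inj (p : {perm 'I_n}) : injective (fun x : pm n => (x.1, p x.2)).
Proof. by move=> [a i] [b j] /= [-> /perm_inj ->]. Qed.

Lemma unsigned_subproof (p : {perm 'I_n}) :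
  perm (@unsigned_inj p) \in hyperoctahedral_group n.
Proof. by rewrite inE; apply/forallP=> x; rewrite !permE. Qed.

(** The standard embedding of the symmetric group in [B_n]. *)
Definition unsigned (p : {perm 'I_n}) : signed_perm n :=
  Subg (unsigned_subproof p).

Lemma sp_fun_unsigned p i : sp_fun (unsigned p) (pm_pos i) = pm_pos (p i).
Proof. by rewrite /sp_fun /= permE. Qed.

Lemma entry_unsigned p i : entry (unsigned p) i = (p i).+1%:Z.
Proof. by rewrite /entry sp_fun_unsigned /pm_int mul1r. Qed.

(** Ordinals start at 0, so these permutations form the copy of [S_3] acting on the first three
    positions. *)
Definition fixes_tail (p : {perm 'I_n}) :=
  forall i : 'I_n, (2 < i)%N -> p i = i.

Definition i0 : 'I_n := ord0.
Definition i1 : 'I_n := inord 1.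
Definition i2 : 'I_n := inord 2.

Lemma fixes_tail_lt p (i : 'I_n) : fixes_tail p -> (i <= 2)%N -> (p i <= 2)%N.
Proof.
move=> fp; rewrite leqNgt (leqNgt (p i)); apply: contra => lt2pi.
by rewrite -(perm_inj (fp _ lt2pi)).
Qed.

Lemma sum_ord_head3 (F : 'I_n -> nat) :
  (forall i : 'I_n, (2 < i)%N -> F i = 0%N) ->
  (\sum_i F i = F i0 + F i1 + F i2)%N.
Proof.
move=> F0; rewrite !big_ord_recl big1 => [|i _]; last exact: F0.
rewrite addn0 addnA; congr (_ + F _ + F _)%N; apply: val_inj;
  by rewrite /= inordK.
Qed.

Lemma sp_inv_unsigned p : fixes_tail p ->
  sp_inv (unsigned p) = ((p i1 < p i0) + (p i2 < p i0) + (p i2 < p i1))%N.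
Proof.
move=> fp; rewrite /sp_inv -sum1dep_card big_mkcond /=.
rewrite -(pair_bigA_idem _ (fun i j : 'I_n =>
  if (i < j)%N && (entry (unsigned p) j < entry (unsigned p) i)
  then 1%N else 0%N)) //=.
(* An inversion with [j] in the tail would need [p i > j], but [p i] is either [i < j] or at most
   2. *)
have F0 (i j : 'I_n) : (2 < j)%N ->
    (if (i < j)%N && (entry (unsigned p) j < entry (unsigned p) i)
     then 1%N else 0%N) = 0%N.
  move=> lt2j; rewrite !entry_unsigned ltz_nat ltnS (fp j) //.
  case: ltnP => //= ltij; case: ltnP => // ltji.
  case: (ltnP 2 i) => [lt2i|le2i].
    by move: ltji; rewrite fp // ltnNge ltnW.
  by have := leq_trans ltji (fixes_tail_lt fp le2i); rewrite leqNgt ltnW.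
rewrite sum_ord_head3 => [|i lt2i]; last first.
  apply: big1 => j _; case: (ltnP 2 j) => [/F0 //|le2j].
  by rewrite ltnNge (leq_trans le2j (ltnW lt2i)).
rewrite !sum_ord_head3; try by move=> j; exact: F0.
rewrite !entry_unsigned !ltz_nat !ltnS /i1 /i2 !inordK //=.
by do 3!case: (_ < _)%N.
Qed.

Lemma sp_neg_unsigned p : sp_neg (unsigned p) = 0.
Proof. by apply: big_pred0 => i; rewrite entry_unsigned. Qed.

Lemma sp_desB_unsigned p : fixes_tail p ->
  sp_desB (unsigned p) = ((p i1 < p i0) + (p i2 < p i1))%N.
Proof.
move=> fp; rewrite /sp_desB -sum1dep_card big_mkcond.
have e0 (i : 'I_n) : entry0 (unsigned p) i.+1 = (p i).+1%:Z.
  by rewrite entry0S entry_unsigned.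
rewrite sum_ord_head3 => [|i lt2i].
  (* All entries are positive, so there is no descent at 0; the descents at 1 and 2 compare the
     three head values. *)
  have v1 : nat_of_ord i1 = i0.+1 by rewrite inordK.
  have v2 : nat_of_ord i2 = i1.+1 by rewrite !inordK.
  rewrite !e0 v1 v2 !e0.
  by rewrite !ltz_nat !ltnS /=; do 2!case: (_ < _)%N.
(* The descent at [i] compares the entries at the ordinals [j = i - 1] and [i]. Here [i] lies in the
   tail, but [j] may still be the last head position. *)
have [j ej] : exists j : 'I_n, nat_of_ord i = j.+1.
  exists (Ordinal (leq_ltn_trans (leq_pred i) (ltn_ord i))).
  by rewrite /= prednK // (leq_trans _ lt2i).
rewrite e0 fp // ej e0 -ej ltz_nat ltnS; case: ltnP => // ltij.
case: (ltnP 2 j) => [lt2j|le2j].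
  by move: ltij; rewrite fp // ej ltnNge leqnSn.
by have := leq_trans ltij (fixes_tail_lt fp le2j); rewrite leqNgt ltnW.
Qed.

(** * The alternating sum over [S_3] *)

Definition s01 : {perm 'I_n} := tperm i0 i1.
Definition s12 : {perm 'I_n} := tperm i1 i2.

Lemma i01 : i0 != i1. Proof. by rewrite -val_eqE /= inordK. Qed.
Lemma i02 : i0 != i2. Proof. by rewrite -val_eqE /= inordK. Qed.
Lemma i12 : i1 != i2. Proof. by rewrite -val_eqE /= !inordK. Qed.

Lemma s01E : (s01 i0 = i1) * (s01 i1 = i0) * (s01 i2 = i2).
Proof. by rewrite /s01 tpermL tpermR tpermD ?i02 ?i12. Qed.

Lemma s12E : (s12 i0 = i0) * (s12 i1 = i2) * (s12 i2 = i1).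
Proof. by rewrite /s12 tpermL tpermR tpermD // eq_sym ?i01 ?i02. Qed.

Lemma tail_neq (i : 'I_n) : (2 < i)%N -> [/\ i0 != i, i1 != i & i2 != i].
Proof.
by move=> lt2i; split; apply: contraTneq lt2i => <-; rewrite ?inordK.
Qed.

Lemma fixes_tail1 : fixes_tail 1.
Proof. by move=> i _; rewrite perm1. Qed.

Lemma fixes_tail01 : fixes_tail s01.
Proof. by move=> i /tail_neq[] *; rewrite tpermD. Qed.

Lemma fixes_tail12 : fixes_tail s12.
Proof. by move=> i /tail_neq[] *; rewrite tpermD. Qed.

Lemma fixes_tailM p q : fixes_tail p -> fixes_tail q -> fixes_tail (p * q)%g.
Proof. by move=> fp fq i lt2i; rewrite permM fp ?fq. Qed.

Lemma head_or_tail (i : 'I_n) : [\/ i = i0, i = i1, i = i2 | (2 < i)%N].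
Proof.
case: i => -[|[|[|i]]] lti; [apply: Or41|apply: Or42|apply: Or43|exact: Or44];
  by apply: val_inj; rewrite /= ?inordK.
Qed.

(** The six elements of [S_3] are written as reduced words in the adjacent transpositions, so each
    sign is the parity of the word length. *)
Definition alt_sum (f : {ffun signed_perm n -> R^o}) : R^o :=
  f (unsigned 1) - f (unsigned s01) - f (unsigned s12)
  + f (unsigned (s01 * s12)%g) + f (unsigned (s12 * s01)%g)
  - f (unsigned (s01 * s12 * s01)%g).

Lemma alt_sum_is_linear : linear alt_sum.
Proof.
move=> c f g; rewrite /alt_sum !ffunE /GRing.scale /=; ring.
Qed.

HB.instance Definition _ :=
  GRing.isLinear.Build R {ffun signed_perm n -> R^o} R^o _ alt_sum
    alt_sum_is_linear.

(** A head position takes each head value once with each sign; a tail position takes the same value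
    in all six terms, three of each sign. *)
Lemma alt_sum_one_value i (g : pm n -> R) :
  alt_sum [ffun w => g (sp_fun w (pm_pos i))] = 0.
Proof.
rewrite /alt_sum !ffunE !sp_fun_unsigned !permM !perm1.
case: (head_or_tail i) => [->|->|->|lt2i].
- by rewrite !(s01E, s12E); ring.
- by rewrite !(s01E, s12E); ring.
- by rewrite !(s01E, s12E); ring.
- by rewrite !(fixes_tail01, fixes_tail12) //; ring.
Qed.

Lemma alt_sum_indicator (K : {set 'I_n * pm n}) :
  (#|K| <= 1)%N -> alt_sum (indicator R K) = 0.
Proof.
move=> /card_le1P; case: (set_0Vmem K) => [-> _|[[i k] iK] /(_ _ iK) defK].
  (* For empty [K] the indicator is the constant 1, a function of the value at any position. *)
  rewrite -[RHS](alt_sum_one_value i0 (fun=> 1)); congr alt_sum.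
  apply/ffunP=> w; rewrite !ffunE; case: forall_inP => // -[] x.
  by rewrite inE.
rewrite -[RHS](alt_sum_one_value i (fun l => (l == k)%:R)); congr alt_sum.
apply/ffunP=> w; rewrite !ffunE; congr (_%:R); congr nat_of_bool.
apply/forall_inP/idP => [/(_ _ iK)//|e [j l]].
by rewrite defK => /eqP[-> ->].
Qed.

Lemma alt_sum_pcp_span f : f \in pcp_span R n 1 -> alt_sum f = 0.
Proof.
suff sK : (pcp_span R n 1 <= lker (linfun alt_sum))%VS.
  by move=> /(subvP sK); rewrite memv_ker lfunE /= => /eqP.
apply/span_subvP => _ /imageP[K /andP[_ sK] ->].
by rewrite memv_ker lfunE /= alt_sum_indicator.
Qed.

Lemma alt_sum_sp_inv : alt_sum (statistic R (fun w => (sp_inv w)%:Z)) = -1.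
Proof.
rewrite /alt_sum !ffunE !sp_inv_unsigned;
  try do ![exact: fixes_tail1 | exact: fixes_tail01 | exact: fixes_tail12
          | apply: fixes_tailM].
(* The inversion numbers are the word lengths: [0 - 1 - 1 + 2 + 2 - 3 = -1]. *)
by rewrite !permM !perm1 !(s01E, s12E) /= !inordK //=; ring.
Qed.

(** Unsigned permutations have no negative entries, so on them this statistic agrees with
    [sp_inv]. *)
Lemma alt_sum_sp_invB : alt_sum (statistic R (@sp_invB n)) = -1.
Proof.
rewrite -[RHS]alt_sum_sp_inv /alt_sum !ffunE /sp_invB.
by rewrite !sp_neg_unsigned !subr0.
Qed.

Lemma alt_sum_sp_desB : alt_sum (statistic R (fun w => (sp_desB w)%:Z)) = -2.
Proof.
rewrite /alt_sum !ffunE !sp_desB_unsigned;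
  try do ![exact: fixes_tail1 | exact: fixes_tail01 | exact: fixes_tail12
          | apply: fixes_tailM].
(* Every word other than the identity and the longest one has a single descent:
   [0 - 1 - 1 + 1 + 1 - 2 = -2]. *)
by rewrite !permM !perm1 !(s01E, s12E) /= !inordK //=; ring.
Qed.

End LowerBound.

Theorem theorem4p20 (R : realType) (n : nat) (hn : (3 <= n)%N) :
  [/\ (statistic R (fun w => (sp_inv w)%:Z) \in pcp_span R n 2)
        /\ (statistic R (fun w => (sp_inv w)%:Z) \notin pcp_span R n 1),
      (statistic R (fun w => sp_invB w) \in pcp_span R n 2)
        /\ (statistic R (fun w => sp_invB w) \notin pcp_span R n 1)
    & (statistic R (fun w => (sp_desB w)%:Z) \in pcp_span R n 2)
        /\ (statistic R (fun w => (sp_desB w)%:Z) \notin pcp_span R n 1)].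
Proof.
case: n hn => [|[|[|m]]] // _.
have N1 : (-1 : R) != 0 by rewrite oppr_eq0 oner_eq0.
have N2 : (-2 : R) != 0 by rewrite oppr_eq0 pnatr_eq0.
split; split.
- exact: sp_inv_in_pcp_span.
- by apply: contra N1 => /alt_sum_pcp_span; rewrite alt_sum_sp_inv => ->.
- exact: sp_invB_in_pcp_span.
- by apply: contra N1 => /alt_sum_pcp_span; rewrite alt_sum_sp_invB => ->.
- exact: sp_desB_in_pcp_span.
- by apply: contra N2 => /alt_sum_pcp_span; rewrite alt_sum_sp_desB => ->.
Qed.
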